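(* Let $m$ and $t$ be positive integers with $\binom{t-1}{3}\le m\le\binom{t-1}{3}+\binom{t-2}{2}-\frac{t-2}{2}$. Let $G$ be a $3$-graph with $m$ edges whose maximum clique has order $t-2$. Then $\lambda(G)<\lambda([t-1]^{(3)})$.
   Context: A $3$-graph $G$ has vertex set $[n]$ and edge set $E\subseteq[n]^{(3)}$; a clique of order $p$ is a set of $p$ vertices all of whose $3$-subsets are edges, and $[p]^{(3)}$ is the complete $3$-graph on $[p]$. For $\vec x\in\mathbb R^n$, $\lambda(G,\vec x)=\sum_{i_1i_2i_3\in E}x_{i_1}x_{i_2}x_{i_3}$, and the Lagrangian is $\lambda(G)=\max\{\lambda(G,\vec x): x_i\ge 0,\ \sum_i x_i=1\}$. *)

(* Defs.v *)
From HB Require Import structures.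
From mathcomp Require Import all_boot all_order all_algebra.
From mathcomp Require Import all_classical all_reals all_analysis.

Set Implicit Arguments.
Unset Strict Implicit.
Unset Printing Implicit Defensive.

Import Order.TTheory GRing.Theory Num.Theory.
Import numFieldNormedType.Exports.
Local Open Scope classical_set_scope.
Local Open Scope ring_scope.

Record graph3 (n : nat) := Graph3 {
  edges : {set {set 'I_n}};
  edges_card3 : [forall e in edges, #|e| == 3%N]
}.

Definition complete3_edges (p : nat) : {set {set 'I_p}} :=
  [set e : {set 'I_p} | #|e| == 3%N]%SET.

Lemma complete3_edges_card3 (p : nat) :
  [forall e in complete3_edges p, #|e| == 3%N].
Proof. by apply/forall_inP => e; rewrite inE. Qed.

Definition complete3 (p : nat) : graph3 p := Graph3 (complete3_edges_card3 p).

(* Every set of at most two vertices is vacuously a clique. *)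
Definition is_clique (n : nat) (G : graph3 n) (K : {set 'I_n}) : bool :=
  [forall e : {set 'I_n}, (e \subset K) && (#|e| == 3%N) ==> (e \in edges G)].

Definition clique_number (n : nat) (G : graph3 n) : nat :=
  \max_(K : {set 'I_n} | is_clique G K) #|K|.

Definition lagrange_poly (R : realType) (n : nat) (G : graph3 n)
    (x : 'rV[R]_n) : R :=
  \sum_(e in edges G) \prod_(i in e) x ord0 i.

Definition simplex (R : realType) (n : nat) : set 'rV[R]_n :=
  [set x | (forall i, 0 <= x ord0 i) /\ \sum_i x ord0 i = 1].
Arguments simplex R n : clear implicits.

(* For n > 0 this supremum is a maximum: see [lagrangian_max]. For n = 0 the
   simplex is empty and the value is 0. *)
Definition lagrangian (R : realType) (n : nat) (G : graph3 n) : R :=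
  sup [set lagrange_poly G x | x in simplex R n].

Lemma lagrange_poly_continuous (R : realType) (n : nat) (G : graph3 n) :
  continuous (lagrange_poly G : 'rV[R]_n -> R).
Proof.
apply: continuous_big => [|e _]; first exact: add_continuous.
apply: continuous_big => [|i _]; first exact: mul_continuous.
exact: coord_continuous.
Qed.

Lemma simplex_compact (R : realType) (n : nat) : compact (simplex R n).
Proof.
pose box := [set v : 'rV[R]_n | forall i, `[0, 1]%classic (v ord0 i)].
pose f (v : 'rV[R]_n) := \sum_i v ord0 i.
have cf : continuous f.
  apply: continuous_big => [|i _]; first exact: add_continuous.
  exact: coord_continuous.
have -> : simplex R n = box `&` f @^-1` [set 1].
  apply/seteqP; split=> x [x0 x1]; split=> // i; last first.
    by have := x0 i; rewrite /= in_itv/= => /andP[].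
  rewrite /= in_itv/= x0 -x1 (bigD1 i)//= lerDl.
  by apply: sumr_ge0 => j _; exact: x0.
apply: compact_closedI.
  apply: (@rV_compact R n (fun=> `[0, 1]%classic)) => _.
  exact: segment_compact.
by move/continuous_closedP: cf; apply; exact: closed_eq.
Qed.

Lemma simplex_nonempty (R : realType) (n : nat) :
  (0 < n)%N -> simplex R n !=set0.
Proof.
case: n => // n _; exists (\row_i (i == ord0)%:R); split=> [i|].
  by rewrite mxE ler0n.
rewrite (bigD1 ord0)//= mxE eqxx big1 ?addr0// => i /negPf i0.
by rewrite mxE i0.
Qed.

Lemma lagrangian_max (R : realType) (n : nat) (G : graph3 n) : (0 < n)%N ->
  exists2 x, simplex R n x & lagrange_poly G x = lagrangian R G /\
    forall y, simplex R n y -> lagrange_poly G y <= lagrange_poly G x.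
Proof.
move=> n0.
have [|x xS xmax] := EVT_max_rV (simplex_nonempty R n0) (@simplex_compact R n)
  (f := lagrange_poly G).
  exact/continuous_subspaceT/lagrange_poly_continuous.
rewrite inE in xS.
have ymax y : simplex R n y -> lagrange_poly G y <= lagrange_poly G x.
  by move=> yS; apply: xmax; rewrite inE.
exists x => //; split => //; apply/eqP; rewrite eq_le; apply/andP; split.
  apply: ub_le_sup; last by exists x.
  by exists (lagrange_poly G x) => _ [y yS <-]; exact: ymax.
apply: ge_sup; first by exists (lagrange_poly G x), x.
by move=> _ [y yS <-]; exact: ymax.
Qed.

(* Main.v *)
Require Import Defs.
From HB Require Import structures.
From mathcomp Require Import all_boot all_order all_algebra.
From mathcomp Require Import all_classical all_reals all_analysis.
From mathcomp Require Import fintype finset zify ring lra.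

Import Order.TTheory GRing.Theory Num.Theory.
Local Open Scope ring_scope.

(** Put s = t - 1 and let x be a maximizer of the Lagrangian polynomial p of G,
    with k positive weights. Assuming p(x) >= C(s,3)/s^3 we get a contradiction:
    - With z = s x, the identity 6 s^3 e_3(x) = s(s-1)(s-2) + (3s-4)(k-s)
      - sum_(x_i > 0) (1 - z_i)^2 (3s - 4 - 2 z_i) settles k < s, and also k = s
      since some triple of the support is not an edge.
    - If k = s + 1, at least 3(s-1)/2 triples of the support are missing. Each
      weighs at least abc, for the three smallest z-values a, b, c <= 4/3, and
      (1-a)^2 (3s-4-2a) + ... + 9(s-1)abc > 3s - 4.
    - If k >= s + 2, let a be the largest weight. Every edge e satisfies
      sum_(i in e) (a - 2 x_i/3) prod_(j in e, j != i) x_j <= a^3. Summing over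
      e, and using that the partial derivatives on the support are >= 3 p(x),
      gives m a^3 >= p(x) (3 k a - 2). The partial derivative at a heaviest
      vertex gives 6 p(x) (k - 1) <= (1 - a)^2 (k - 2), which is incompatible. *)

Set Implicit Arguments.
Unset Strict Implicit.
Unset Printing Implicit Defensive.

(** * Polynomial inequalities in the rescaled weights *)

(** Half the difference of the two sides in [triple_weight_gt] at [s = 4] and [c = b]. *)
Lemma cubic_pair_gt0 (R : realFieldType) (a b : R) :
  0 < a -> a <= 4/3 -> b <= 4 ->
  0 < 2 * ((1 - b) ^+ 2 * (4 - b)) + (1 - a) ^+ 2 * (4 - a)
      + 27 / 2 * (a * b ^+ 2) - 4.
Proof.
move=> a0 a43 b4; set F := (X in 0 < X).
pose u := 1 - b; have bE : b = 1 - u by rewrite /u; ring.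
have [u0|u0] := leP u 0.
  have : 0 <= u ^+ 2 * (3 + u) by apply: mulr_ge0; [exact: sqr_ge0|lra].
  have au : 0 <= a * - u by apply: mulr_ge0; lra.
  have a2 : 0 < a ^+ 2 by rewrite exprn_gt0.
  have au2 : 0 <= a * u ^+ 2 by rewrite mulr_ge0 ?sqr_ge0// ltW.
  have a3 : 0 <= a ^+ 2 * (6 - a) by apply: mulr_ge0; lra.
  rewrite /F bE; lra.
(* Splitting off [2 * (u * (u - a) ^+ 2)] removes the cubic term in [u]; the quadratic [G] is
   handled by completing the square. *)
pose G := (6 + 35/2*a) * u ^+ 2 - (27*a + 2*a^+2) * u + 9/2*a + 6*a^+2 - a^+3.
have FG : F = G + 2 * (u * (u - a) ^+ 2) by rewrite /F /G bE; field.
suff : 0 < G.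
  have : 0 <= u * (u - a) ^+ 2 by rewrite mulr_ge0 ?sqr_ge0// ltW.
  rewrite FG; lra.
have c0 : 0 < 6 + 35/2*a by lra.
rewrite -(pmulr_rgt0 _ c0).
have -> : (6 + 35/2*a) * G = ((6 + 35/2*a) * u - (27*a + 2*a^+2) / 2) ^+ 2
    + a / 4 * (108 - 270 * a + 288 * a ^+ 2 - 74 * a ^+ 3).
  by rewrite /G; field.
have : 0 < 108 - 270 * a + 288 * a ^+ 2 - 74 * a ^+ 3.
  have : 0 <= a ^+ 2 * (4/3 - a) by apply: mulr_ge0; [exact: sqr_ge0|lra].
  (* [5/7] is close to the minimizer of the quadratic left after bounding [a ^+ 3] by
     [4/3 * a ^+ 2]. *)
  have := sqr_ge0 (a - 5/7); lra.
move=> D0; apply: ltr_wpDl; first exact: sqr_ge0.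
by apply: mulr_gt0 => //; lra.
Qed.

(* After fixing [b + c] the difference is affine in [b * c], so only the
   extreme cases [b * c = 0] and [b = c] matter. *)
Lemma triple_weight_gt (R : realFieldType) (s a b c : R) : 4 <= s ->
  0 < a -> a <= 4/3 -> 0 < b -> b <= 4/3 -> 0 < c -> c <= 4/3 ->
  3 * s - 4 < (1 - a) ^+ 2 * (3 * s - 4 - 2 * a)
            + (1 - b) ^+ 2 * (3 * s - 4 - 2 * b)
            + (1 - c) ^+ 2 * (3 * s - 4 - 2 * c) + 9 * (s - 1) * (a * b * c).
Proof.
move=> s4 a0 a43 b0 b43 c0 c43; rewrite -subr_gt0.
pose B := (1 - a) ^+ 2 + (1 - b) ^+ 2 + (1 - c) ^+ 2 + 3 * (a * b * c) - 1.
pose T := (1 - a) ^+ 2 * (4 - a) + (1 - b) ^+ 2 * (4 - b)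
  + (1 - c) ^+ 2 * (4 - c) + 27 / 2 * (a * b * c) - 4.
set E := (X in 0 < X).
(* [E] is affine in [s], with slope [3 * B] and value [2 * T] at [s = 4]. *)
have -> : E = 3 * (s - 4) * B + 2 * T by rewrite /E /B /T; field.
pose S := b + c; have S0 : 0 < S by rewrite /S addr_gt0.
have S2 : 0 < S ^+ 2 by rewrite exprn_gt0.
have P0 : 0 < 4 * (b * c) by rewrite !mulr_gt0.
have PS : 0 <= S ^+ 2 - 4 * (b * c).
  by have := sqr_ge0 (b - c); rewrite /S; lra.
have B0 : 0 <= B.
  rewrite -(pmulr_rge0 _ S2).
  (* Interpolation between the values of [B] at [b * c = 0] and at [b = c = S / 2]; the coefficients
     add up to [S ^+ 2]. [T] is split in the same way below. *)
  have -> : S ^+ 2 * B = (S ^+ 2 - 4 * (b * c)) * ((a - 1) ^+ 2 + (S - 1) ^+ 2)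
      + 4 * (b * c) * (2 * (1 - S / 2) ^+ 2 + a ^+ 2 - 2 * a + 3 * (a * (S / 2) ^+ 2)).
    by rewrite /S /B; field.
  apply: addr_ge0; first by rewrite mulr_ge0// addr_ge0 ?sqr_ge0.
  apply: mulr_ge0; first exact: ltW.
  have c1 : 0 < 2 + 3 * a by lra.
  rewrite -(pmulr_rge0 _ c1).
  set y := S / 2.
  have -> : (2 + 3 * a) * (2 * (1 - y) ^+ 2 + a ^+ 2 - 2 * a + 3 * (a * y ^+ 2))
     = ((2 + 3 * a) * y - 2) ^+ 2 + a * (3 * (a - 2/3) ^+ 2 + 2/3) by field.
  apply: addr_ge0; first exact: sqr_ge0.
  by apply: mulr_ge0; [exact: ltW | have := sqr_ge0 (a - 2/3); lra].
suff T0 : 0 < T.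
  have : 0 <= (s - 4) * B by apply: mulr_ge0 => //; lra.
  lra.
rewrite -(pmulr_rgt0 _ S2).
have -> : S ^+ 2 * T = (S ^+ 2 - 4 * (b * c))
      * ((1 - S) ^+ 2 * (4 - S) + (1 - a) ^+ 2 * (4 - a))
    + 4 * (b * c) * (2 * ((1 - S / 2) ^+ 2 * (4 - S / 2)) + (1 - a) ^+ 2 * (4 - a)
      + 27 / 2 * (a * (S / 2) ^+ 2) - 4).
  by rewrite /S /T; field.
apply: ltr_wpDl.
  apply: mulr_ge0 => //; apply: addr_ge0; apply: mulr_ge0; rewrite ?sqr_ge0//.
    by rewrite /S; lra.
  lra.
by apply: mulr_gt0 => //; apply: cubic_pair_gt0 => //; rewrite /S; lra.
Qed.

(** [A] is [s] times the largest weight, and the last hypothesis is the derivative bound at a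
    heaviest vertex. The right-hand side increases with [k * A], so each range of [A] only needs a
    suitable lower bound of [k * A]. *)
Lemma large_support_ineq (R : realFieldType) (s k A : R) : 4 <= s -> s + 2 <= k ->
  s <= k * A -> A < s -> (k - 1) * ((s - 1) * (s - 2)) <= (s - A) ^+ 2 * (k - 2) ->
  (s ^+ 2 + s - 9) * A ^+ 3 < (s - 2) * (3 * k * A - 2 * s).
Proof.
move=> s4 ks sk As H.
have s2 : 0 < s - 2 by lra.
have A0 : 0 < A by rewrite -(pmulr_rgt0 _ (_ : 0 < k)); lra.
have q0 : 0 <= (s - 4) ^+ 2 by exact: sqr_ge0.
have c0 : 0 < s ^+ 2 + s - 9 by lra.
have q1 : 0 <= (s - 4) ^+ 3 by apply: exprn_ge0; lra.
have mono B : B <= k * A -> (s ^+ 2 + s - 9) * A ^+ 3 < (s - 2) * (3 * B - 2 * s) ->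
    (s ^+ 2 + s - 9) * A ^+ 3 < (s - 2) * (3 * k * A - 2 * s).
  move=> Bk /lt_le_trans; apply; rewrite ler_pM2l//; lra.
have sA : (s + 2) * A <= k * A by rewrite ler_pM2r.
pose e := A - 1; have AE : A = 1 + e by rewrite /e; ring.
have [A1|A1] := leP A 1.
  have [As1|As1] := leP ((s + 2) * A) s.
    apply: (mono s) => //.
    have p0 : 0 < (s + 2) ^+ 3 by rewrite exprn_gt0//; lra.
    rewrite -(ltr_pM2l p0).
    apply: (@le_lt_trans _ _ ((s ^+ 2 + s - 9) * s ^+ 3)).
      rewrite [leLHS](_ : _ = (s ^+ 2 + s - 9) * ((s + 2) * A) ^+ 3); last by ring.
      rewrite ler_pM2l// lerXn2r// ?nnegrE; last by lra.
      by apply: mulr_ge0; lra.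
    rewrite -subr_gt0 [ltRHS](_ : _ = s * (3 * s ^+ 3 + 9 * s ^+ 2 - 16 * s - 16)).
      by apply: mulr_gt0; lra.
    by ring.
  apply: (mono _ sA).
  (* [y] is [1 - A] in units of [1 / (s + 2)]; the current range of [A] places it in [[0, 2]]. *)
  pose y := (s + 2) * - e.
  have y0 : 0 <= y by apply: mulr_ge0; rewrite /e; lra.
  have y2 : y <= 2 by rewrite /y /e; lra.
  have p0 : 0 < (s + 2) ^+ 2 by rewrite exprn_gt0//; lra.
  have e3 : 0 <= (s ^+ 2 + s - 9) * (- e) ^+ 3.
    by apply: mulr_ge0; [exact: ltW | apply: exprn_ge0; rewrite /e; lra].
  rewrite -subr_gt0.
  rewrite [ltRHS](_ : _ = (s ^+ 2 + s - 9) * (- e) ^+ 3 +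
    (3 * s - 3 - e * (3 * s - 15) - 3 * (s ^+ 2 + s - 9) * e ^+ 2)); last first.
    by rewrite AE; ring.
  apply: ltr_wpDl => //.
  rewrite -(pmulr_rgt0 _ p0) [ltRHS](_ : _ = 3 * (s - 1) * (s + 2) ^+ 2
     + 3 * (s - 4) * (s + 2) * y - 3 * (s + 2) * y
      - 3 * (s ^+ 2 + s - 9) * y ^+ 2); last by rewrite /y; ring.
  have h1 : 0 <= (s - 4) * (s + 2) * y by rewrite !mulr_ge0//; lra.
  have h2 : 0 <= (s + 2) * (2 - y) by rewrite !mulr_ge0//; lra.
  have h3 : 0 <= (s ^+ 2 + s - 9) * ((2 - y) * (2 + y)).
    by rewrite !mulr_ge0//; lra.
  lra.
have e0 : 0 < e by rewrite /e; lra.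
(* Up to [A = 1 + 1 / s] the bound [s + 2 <= k] suffices; beyond it, [H] provides a better lower
   bound of [k]. *)
have [es|es] := leP (s * e) 1.
  apply: (mono _ sA); rewrite -subr_gt0.
  rewrite [ltRHS](_ : _ = 3 * s - 3 - 3 * (s * e) + 15 * e
    - (3 + e) * ((s * e) ^+ 2 + (s * e) * e - 9 * e ^+ 2)); last by rewrite AE; ring.
  have e4 : e <= 1/4.
    have : 0 <= (s - 4) * e by apply: mulr_ge0; lra.
    lra.
  have se0 : 0 <= s * e by apply: mulr_ge0; lra.
  have d1 : (s * e) ^+ 2 <= 1 by rewrite exprn_ile1.
  have d2 : (s * e) * e <= 1/4 by rewrite -[leRHS]mul1r ler_pM// ltW.
  have d3 : (3 + e) * ((s * e) ^+ 2 + (s * e) * e - 9 * e ^+ 2) <= (3 + e) * (5/4).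
    rewrite ler_pM2l; last lra.
    have := sqr_ge0 e; lra.
  lra.
have se : 3 * (e * (s - 1 - e)) >= 0 by rewrite !mulr_ge0//; rewrite /e; lra.
(* Writing [k - 1 = (k - 2) + 1] in [H] and collecting [k - 2] produces [D]. *)
pose D := (s - 1) * (1 - 2 * e) + e ^+ 2.
have HD : (s - 1) * (s - 2) <= (k - 2) * D.
  rewrite -subr_ge0 in H; rewrite -subr_ge0; apply: le_trans H _.
  by rewrite AE /D le_eqVlt; apply/orP; left; apply/eqP; ring.
have D0 : 0 < D.
  have : 0 < (k - 2) * D by apply: lt_le_trans HD; apply: mulr_gt0; lra.
  by rewrite pmulr_rgt0//; lra.
(* [1 + 2 * e + 3 * e ^+ 2] is a polynomial lower bound of [(s - 1) / D]. *)
have kD : (s - 2) * (1 + 2 * e + 3 * e ^+ 2) <= k - 2.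
  rewrite -(ler_pM2r D0); apply: le_trans HD.
  rewrite -mulrA [leRHS]mulrC ler_pM2l// -subr_ge0.
  rewrite [leRHS](_ : _ = e ^+ 2 * ((s - 1) * (1 + 3 * e) - 1 - 2 * e
     + 3 * (e * (s - 1 - e)))); last by rewrite /D; ring.
  apply: mulr_ge0; first exact: sqr_ge0.
  have : 0 <= (s - 4) * e by apply: mulr_ge0; lra.
  lra.
apply: (mono ((2 + (s - 2) * (1 + 2 * e + 3 * e ^+ 2)) * A)).
  by rewrite ler_pM2r//; lra.
rewrite -subr_gt0 [ltRHS](_ : _ = 9 - 3 * s + (6 * s ^+ 2 - 33 * s + 51) * e
   + (12 * s ^+ 2 - 63 * s + 87) * e ^+ 2 + (8 * s ^+ 2 - 37 * s + 45) * e ^+ 3).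
  have s0 : 0 < s ^+ 2 by rewrite exprn_gt0//; lra.
  apply: ltr_wpDr.
    by apply: mulr_ge0; [lra | apply: exprn_ge0; exact: ltW].
  rewrite -(pmulr_rgt0 _ s0) [ltRHS](_ : _ = (9 - 3 * s) * s ^+ 2
     + (6 * s ^+ 2 - 33 * s + 51) * s * (s * e)
     + (12 * s ^+ 2 - 63 * s + 87) * (s * e) ^+ 2); last by ring.
  have h1 : 0 <= (6 * s ^+ 2 - 33 * s + 51) * s * (s * e - 1).
    have := sqr_ge0 (s - 11/4).
    by move=> ?; rewrite !mulr_ge0//; lra.
  have h2 : 0 <= (12 * s ^+ 2 - 63 * s + 87) * ((s * e - 1) * (s * e + 1)).
    by rewrite !mulr_ge0//; lra.
  lra.
by rewrite AE; ring.
Qed.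

(** * Elementary symmetric polynomials and edge polynomials *)

Definition elsym (R : comNzRingType) (T : finType) (r : nat) (S : {set T})
    (x : T -> R) : R :=
  \sum_(f : {set T} | (f \subset S) && (#|f| == r)) \prod_(i in f) x i.

(** Weights are functions on a finite type instead of row vectors; for [x i = v ord0 i] this is
    [lagrange_poly]. *)
Definition epoly (R : comNzRingType) (T : finType) (E : {set {set T}})
    (x : T -> R) : R :=
  \sum_(e in E) \prod_(i in e) x i.

Definition epoly_deriv (R : comNzRingType) (T : finType) (E : {set {set T}})
    (x : T -> R) (i : T) : R :=
  \sum_(e in E | i \in e) \prod_(j in e :\ i) x j.

Lemma sum_sets_mem (V : nmodType) (T : finType) (a : T) (P : pred {set T})
    (F : {set T} -> V) :
  \sum_(f | P f && (a \in f)) F f =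
  \sum_(f : {set T} | P (a |: f) && (a \notin f)) F (a |: f).
Proof.
rewrite (reindex_onto (fun f : {set T} => a |: f) (fun f => f :\ a)) /=; last first.
  by move=> f /andP[_ af]; rewrite setD1K.
apply: eq_bigl => f; rewrite setU11 andbT; congr (_ && _).
apply/eqP/idP => [<-|af]; first by rewrite setD11.
by rewrite setU1K.
Qed.

Lemma elsym0 (R : comNzRingType) (T : finType) (S : {set T}) (x : T -> R) :
  elsym 0 S x = 1.
Proof.
rewrite /elsym (bigD1 set0) ?sub0set ?cards0//= big_set0 big1 ?addr0// => f.
by rewrite cards_eq0 => /andP[/andP[_ /eqP->]]; rewrite eqxx.
Qed.

Lemma elsym_set0 (R : comNzRingType) (T : finType) (r : nat) (x : T -> R) :
  elsym r.+1 set0 x = 0.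
Proof.
by rewrite /elsym big1// => f; rewrite subset0 => /andP[/eqP->]; rewrite cards0.
Qed.

(** Pascal's recursion: a subset either contains [a] or avoids it. *)
Lemma elsymU1 (R : comNzRingType) (T : finType) (r : nat) (a : T) (S : {set T})
    (x : T -> R) : a \notin S ->
  elsym r.+1 (a |: S) x = x a * elsym r S x + elsym r.+1 S x.
Proof.
move=> aS; rewrite /elsym (bigID (fun f : {set T} => a \in f)) /=; congr (_ + _).
  rewrite sum_sets_mem big_distrr /=; apply: eq_big => f.
    have [af|af] := boolP (a \in f).
      rewrite andbF; apply/esym/negP => /andP[/subsetP/(_ _ af)].
      by rewrite (negPf aS).
    rewrite andbT cardsU1 af eqSS; congr (_ && _).
    apply/idP/idP => [/subsetP h|]; last exact: setUS.
    apply/subsetP => i fi; have := h i; rewrite !inE fi orbT => /(_ isT).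
    by case/orP => // /eqP ia; rewrite ia (negPf af) in fi.
  by case/andP => _ af; rewrite big_setU1.
apply: eq_bigl => f; rewrite andbAC; congr (_ && _).
apply/andP/idP => [[/subsetP h af]|h].
  apply/subsetP => i fi; have := h i fi; rewrite !inE.
  by case/orP => // /eqP ia; rewrite ia (negPf af) in fi.
split; first exact: subset_trans h (subsetUr _ _).
by apply: contra aS; apply/subsetP.
Qed.

Lemma finset_ind (T : finType) (P : {set T} -> Prop) : P set0 ->
  (forall a (S : {set T}), a \notin S -> P S -> P (a |: S)) -> forall S, P S.
Proof.
move=> P0 PU S; have [k] := ubnP #|S|; elim: k S => // k IH S Sk.
have [->//|[a aS]] := set_0Vmem S.
rewrite -(setD1K aS); apply: PU; first by rewrite setD11.
by apply: IH; move: Sk; rewrite (cardsD1 a) aS.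
Qed.

Lemma elsym1E (R : comNzRingType) (T : finType) (S : {set T}) (x : T -> R) :
  elsym 1 S x = \sum_(i in S) x i.
Proof.
elim/finset_ind: S => [|a S aS IH]; first by rewrite elsym_set0 big_set0.
by rewrite elsymU1// elsym0 IH mulr1 big_setU1.
Qed.

(** Newton's identity, kept free of division; [elsym3E] is its analogue in degree 3. *)
Lemma elsym2E (R : comNzRingType) (T : finType) (S : {set T}) (x : T -> R) :
  2 * elsym 2 S x = (\sum_(i in S) x i) ^+ 2 - \sum_(i in S) x i ^+ 2.
Proof.
elim/finset_ind: S => [|a S aS IH]; first by rewrite elsym_set0 !big_set0; ring.
by rewrite elsymU1// mulrDr IH elsym1E !big_setU1//=; ring.
Qed.

Lemma elsym3E (R : comNzRingType) (T : finType) (S : {set T}) (x : T -> R) :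
  6 * elsym 3 S x = (\sum_(i in S) x i) ^+ 3
    - 3 * (\sum_(i in S) x i) * (\sum_(i in S) x i ^+ 2)
    + 2 * \sum_(i in S) x i ^+ 3.
Proof.
elim/finset_ind: S => [|a S aS IH]; first by rewrite elsym_set0 !big_set0; ring.
rewrite elsymU1// mulrDr IH !big_setU1//=.
have -> : 6 * (x a * elsym 2 S x) = 3 * x a * (2 * elsym 2 S x) by ring.
by rewrite elsym2E; ring.
Qed.

Lemma cards3P (T : finType) (A : {set T}) : #|A| = 3%N ->
  exists a b c, [/\ a \notin b |: [set c], b \notin [set c] & A = a |: (b |: [set c])].
Proof.
move=> A3; have [A0|[a aA]] := set_0Vmem A; first by rewrite A0 cards0 in A3.
have /eqP : #|A :\ a| = 2%N by move: A3; rewrite (cardsD1 a) aA => -[].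
case/cards2P => b [c [bc Aa]]; exists a, b, c; split.
- by rewrite -[_ |: _]Aa setD11.
- by rewrite inE.
- by rewrite -[X in _ |: X]Aa setD1K.
Qed.

(** * Partial derivatives at a maximizer *)

Section Weights.
Context (R : realFieldType) (T : finType) (E : {set {set T}}).
Implicit Types x : T -> R.

Lemma prod_set_ge0 x (e : {set T}) : (forall i, 0 <= x i) -> 0 <= \prod_(i in e) x i.
Proof. by move=> x0; apply: prodr_ge0. Qed.

Lemma epoly_deriv_ge0 x i : (forall j, 0 <= x j) -> 0 <= epoly_deriv E x i.
Proof. by move=> x0; apply: sumr_ge0 => e _; exact: prod_set_ge0. Qed.

(** An edge contains [i] at most once, so the polynomial is affine in [x i] and the first-order
    expansion is exact. *)
Lemma epoly_shift x (i : T) (d : R) :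
  epoly E (fun j => x j - d * (j == i)%:R) = epoly E x - d * epoly_deriv E x i.
Proof.
have other (A : {set T}) : i \notin A ->
    \prod_(j in A) (x j - d * (j == i)%:R) = \prod_(j in A) x j.
  move=> iA; apply: eq_bigr => j jA.
  by case: eqP => [ji|_]; [rewrite ji (negPf iA) in jA | rewrite mulr0 subr0].
rewrite /epoly /epoly_deriv (bigID (fun e : {set T} => i \in e)) /=.
rewrite [X in _ = X - _](bigID (fun e : {set T} => i \in e)) /=.
rewrite addrAC; congr (_ + _); last by apply: eq_bigr => e /andP[_]; exact: other.
rewrite big_distrr -sumrB; apply: eq_bigr => e /andP[_ ie].
rewrite !(big_setD1 i ie)/= other ?setD11// eqxx /=; ring.
Qed.

Lemma epoly_scale x (c : R) : (forall e, e \in E -> #|e| = 3%N) ->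
  epoly E (fun j => c * x j) = c ^+ 3 * epoly E x.
Proof.
move=> E3; rewrite /epoly big_distrr; apply: eq_bigr => e eE.
by rewrite big_split prodr_const/= E3.
Qed.

Lemma sum_epoly_deriv x (c : T -> R) :
  \sum_i c i * epoly_deriv E x i =
  \sum_(e in E) \sum_(i in e) c i * \prod_(j in e :\ i) x j.
Proof.
under eq_bigr => i _ do rewrite big_distrr /=.
rewrite (exchange_big_dep (fun e => e \in E))/=; last by move=> i e _ /andP[].
by apply: eq_bigr => e eE; apply: eq_bigl => i; rewrite eE.
Qed.

(* Removing weight [d] from [i] and renormalizing gives
   [p - d * p_i <= p * (1 - d) ^+ 3] for the value [p] and the partial
   derivative [p_i] at [x]; let [d] tend to 0. *)
Lemma epoly_deriv_max x : (forall e, e \in E -> #|e| = 3%N) ->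
    (forall i, 0 <= x i) -> \sum_i x i = 1 ->
    (forall y, (forall i, 0 <= y i) -> \sum_i y i = 1 -> epoly E y <= epoly E x) ->
  forall i, 0 < x i -> 3 * epoly E x <= epoly_deriv E x i.
Proof.
move=> E3 x0 x1 xmax i xi; set p := epoly E x; set q := epoly_deriv E x i.
have p0 : 0 <= p by apply: sumr_ge0 => e _; exact: prod_set_ge0.
have xi1 : x i <= 1 by rewrite -x1 (bigD1 i)//= lerDl; apply: sumr_ge0.
rewrite leNgt; apply/negP => qp.
(* The first bound keeps the weight of [i] nonnegative. The second gives
   [3 * p * d + d <= 3 * p - q], whereas maximality will give [3 * p - q <= 3 * p * d]. *)
pose d := Num.min (x i / 2) ((3 * p - q) / (3 * p + 1)).
have d0 : 0 < d by rewrite lt_min !divr_gt0//; lra.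
have dx : d <= x i / 2 by rewrite ge_min lexx.
have dp : d * (3 * p + 1) <= 3 * p - q.
  by rewrite -ler_pdivlMr ?ge_min ?lexx ?orbT//; lra.
have d1 : 0 < 1 - d by lra.
pose y j := (1 - d)^-1 * (x j - d * (j == i)%:R).
have : epoly E y <= p.
  apply: xmax => [j|].
    rewrite /y mulr_ge0 ?invr_ge0 ?(ltW d1)//.
    by have := x0 j; case: eqP => [->|_]; rewrite ?mulr1 ?mulr0; lra.
  rewrite -big_distrr/= sumrB x1 -big_distrr/= (bigD1 i)//= eqxx big1.
    by rewrite addr0 mulr1 mulVf// gt_eqF.
  by move=> j /negPf->.
rewrite epoly_scale// epoly_shift exprVn mulrC ler_pdivrMr ?exprn_gt0//.
rewrite -/p -/q.
have : 0 <= p * d ^+ 3 by rewrite mulr_ge0 ?exprn_ge0// ltW.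
move=> h1 h2.
have : d * (3 * p - q) <= d * (3 * p * d) by rewrite -subr_ge0; lra.
rewrite ler_pM2l//; lra.
Qed.

End Weights.

(** * Binomial coefficients and the weight of one edge *)

Lemma bin2_natr (R : numDomainType) (s : nat) :
  2 * 'C(s, 2)%:R = s%:R * (s%:R - 1) :> R.
Proof.
elim: s => [|s IH]; first by rewrite bin0n mulr0 !mul0r.
by rewrite binS bin1 natrD mulrDr IH -natr1; ring.
Qed.

Lemma bin3_natr (R : numDomainType) (s : nat) :
  6 * 'C(s, 3)%:R = s%:R * (s%:R - 1) * (s%:R - 2) :> R.
Proof.
elim: s => [|s IH]; first by rewrite bin0n mulr0 !mul0r.
rewrite binS natrD mulrDr IH.
have -> : 6 * 'C(s, 2)%:R = 3 * (2 * 'C(s, 2)%:R) :> R by ring.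
by rewrite bin2_natr -natr1; ring.
Qed.

(* With [x = a * z] the left-hand side is [a ^+ 3] times the probability that
   at least two of three independent events of probabilities [z i] occur. *)
Lemma edge_weight_le (R : realFieldType) (T : finType) (x : T -> R) (a : R)
    (e : {set T}) : 0 < a -> (forall i, 0 <= x i) -> (forall i, x i <= a) ->
  #|e| = 3%N -> \sum_(i in e) (a - 2 / 3 * x i) * \prod_(j in e :\ i) x j <= a ^+ 3.
Proof.
move=> a0 x0 xa /cards3P [u [v [w [uvw vw ->]]]].
have uv : u != v by move: uvw; rewrite !inE negb_or => /andP[].
have uw : u \notin [set w] by move: uvw; rewrite !inE negb_or => /andP[].
have wuv : w \notin v |: [set u].
  by move: uw vw; rewrite !inE negb_or eq_sym => -> ; rewrite eq_sym => ->.
have vuw : v \notin u |: [set w].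
  by rewrite !inE negb_or eq_sym uv; move: vw; rewrite inE.
rewrite (big_setU1 _ uvw)/= (big_setU1 _ vw)/= big_set1.
rewrite (setU1K uvw) [in X in _ + (_ * X + _)]setUCA (setU1K vuw).
rewrite [in X in _ + (_ + _ * X)](_ : u |: (v |: [set w]) = w |: (v |: [set u]));
  last first.
  by apply/setP => i; rewrite !inE; case: (i == u); case: (i == v); case: (i == w).
rewrite (setU1K wuv) (big_setU1 _ vw)/= (big_setU1 _ uw)/=.
rewrite big_setU1/= ?big_set1; last by rewrite inE eq_sym.
(* The cases where none or exactly one of the three events occurs; the four products add up to the
   difference of the two sides. *)
have p : 0 <= (a - x u) * (a - x v) * (a - x w) by rewrite !mulr_ge0// subr_ge0.
have p1 : 0 <= (a - x u) * (a - x v) * x w by rewrite !mulr_ge0// subr_ge0.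
have p2 : 0 <= (a - x u) * x v * (a - x w) by rewrite !mulr_ge0// subr_ge0.
have p3 : 0 <= x u * (a - x v) * (a - x w) by rewrite !mulr_ge0// subr_ge0.
lra.
Qed.

(** * Bounds according to the size of the support *)

Section Support.
Context (R : realFieldType) (T : finType) (E : {set {set T}}) (x : T -> R).
Context (x0 : forall i, 0 <= x i) (x1 : \sum_i x i = 1).
Context (E3 : forall e, e \in E -> #|e| = 3%N).

Let S := [set i | 0 < x i].
Let p := epoly E x.
Let missing := [set f : {set T} | (f \subset S) && (#|f| == 3%N) && (f \notin E)].

Lemma supportPn i : i \notin S -> x i = 0.
Proof. by rewrite inE lt_neqAle x0 andbT negbK => /eqP. Qed.

Lemma sum_support (F : T -> R) : (forall i, x i = 0 -> F i = 0) ->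
  \sum_(i in S) F i = \sum_i F i.
Proof.
move=> F0; rewrite [RHS](bigID (mem S))/= [X in _ + X]big1 ?addr0// => i iS.
by rewrite F0// supportPn.
Qed.

(** An edge leaving [S] has weight zero, so only triples inside [S] count. *)
Lemma epoly_missing :
  p + \sum_(f in missing) \prod_(i in f) x i = elsym 3 S x.
Proof.
rewrite /elsym [RHS](bigID (mem E))/=; congr (_ + _); last first.
  by apply: eq_bigl => f; rewrite inE.
rewrite /p /epoly (bigID (fun e : {set T} => e \subset S))/= [X in _ + X]big1.
  rewrite addr0; apply: eq_bigl => e.
  by have [eE|] := boolP (e \in E); rewrite ?andbT ?andbF// E3// eqxx andbT.
move=> e /andP[_ /subsetPn[i ie iS]].
by rewrite (big_setD1 i)//= supportPn// mul0r.
Qed.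

Lemma card_missing : ('C(#|S|, 3) <= #|missing| + #|E|)%N.
Proof.
rewrite -cards_draws.
apply: (@leq_trans #|missing :|: E|); last by rewrite cardsU leq_subr.
apply/subset_leq_card/subsetP => f; rewrite !inE => ->.
by rewrite orNb.
Qed.

Lemma weight_le1 i : x i <= 1.
Proof. by rewrite -x1 (bigD1 i)//= lerDl sumr_ge0. Qed.

Lemma sum_support1 : \sum_(i in S) x i = 1.
Proof. by rewrite sum_support. Qed.

(** Newton's identity for total weight 1, arranged so that the subtracted sum vanishes when all
    weights on [S] are [1 / s]. *)
Lemma elsym3_support (s : R) :
  6 * s ^+ 3 * elsym 3 S x = s * (s - 1) * (s - 2) + (3 * s - 4) * (#|S|%:R - s)
    - \sum_(i in S) (1 - s * x i) ^+ 2 * (3 * s - 4 - 2 * (s * x i)).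
Proof.
have -> : \sum_(i in S) (1 - s * x i) ^+ 2 * (3 * s - 4 - 2 * (s * x i)) =
    (3 * s - 4) * #|S|%:R - (6 * s ^+ 2 - 6 * s) * (\sum_(i in S) x i)
     + 3 * s ^+ 3 * (\sum_(i in S) x i ^+ 2) - 2 * s ^+ 3 * (\sum_(i in S) x i ^+ 3).
  rewrite -sumr_const !mulr_sumr -sumrB -big_split/= -sumrB.
  by apply: eq_bigr => i _; ring.
have -> : 6 * s ^+ 3 * elsym 3 S x = s ^+ 3 * (6 * elsym 3 S x) by ring.
by rewrite elsym3E sum_support1; ring.
Qed.

Lemma weight_ge0 (s : R) i : 4 <= s ->
  0 <= (1 - s * x i) ^+ 2 * (3 * s - 4 - 2 * (s * x i)).
Proof.
move=> s4; rewrite mulr_ge0 ?sqr_ge0//.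
have : s * x i <= s * 1 by rewrite ler_wpM2l ?weight_le1//; lra.
lra.
Qed.

Lemma small_support (s : nat) : (4 <= s)%N -> (#|S| <= s)%N ->
    (forall K : {set T}, #|K| = s -> exists2 f : {set T},
       (f \subset K) && (#|f| == 3%N) & f \notin E) ->
  6 * s%:R ^+ 3 * p < s%:R * (s%:R - 1) * (s%:R - 2).
Proof.
move=> s4 Ss noK; have s4R : 4 <= s%:R :> R by rewrite (ler_nat _ 4).
have pE := epoly_missing; have sE := elsym3_support s%:R.
have W : 0 <= \sum_(i in S) (1 - s%:R * x i) ^+ 2 * (3 * s%:R - 4 - 2 * (s%:R * x i)).
  by apply: sumr_ge0 => i _; exact: weight_ge0.
have M : 0 <= \sum_(f in missing) \prod_(i in f) x i.
  by apply: sumr_ge0 => f _; exact: prod_set_ge0.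
have s3 : 0 < 6 * s%:R ^+ 3 :> R by rewrite mulr_gt0// exprn_gt0//; lra.
have {}pE : 6 * s%:R ^+ 3 * p = 6 * s%:R ^+ 3 * elsym 3 S x
    - 6 * s%:R ^+ 3 * \sum_(f in missing) \prod_(i in f) x i by rewrite -pE; ring.
rewrite pE sE.
have [lt_k|ge_k] := ltnP #|S| s.
  have : 0 < (3 * s%:R - 4) * (s%:R - #|S|%:R) :> R.
    by rewrite mulr_gt0 ?subr_gt0 ?ltr_nat//; lra.
  have : 0 <= 6 * s%:R ^+ 3 * \sum_(f in missing) \prod_(i in f) x i.
    by rewrite mulr_ge0// ltW.
  lra.
(* The term in [#|S| - s] vanishes now; strictness comes from a missing triple, whose three weights
   are positive. *)
have Sk : #|S| = s by apply/eqP; rewrite eqn_leq Ss.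
rewrite Sk subrr mulr0 addr0.
have : 0 < \sum_(f in missing) \prod_(i in f) x i.
  have [f /andP[fS f3] fE] := noK S Sk.
  rewrite (bigD1 f) ?inE ?fS ?f3//= ltr_pwDl//.
    by apply: prodr_gt0 => i fi; move/subsetP/(_ i fi): fS; rewrite inE.
  by apply: sumr_ge0 => g _; exact: prod_set_ge0.
by rewrite -(pmulr_rgt0 _ s3); lra.
Qed.

(* A triple of [S] with minimal product consists of three smallest weights:
   otherwise exchanging one of its elements would decrease the product. *)
Lemma min_triple (k : nat) : #|S| = k.+4 -> exists f : {set T},
  [/\ f \subset S, #|f| = 3%N,
    forall g : {set T}, g \subset S -> #|g| = 3%N ->
      \prod_(i in f) x i <= \prod_(i in g) x i
    & forall i, i \in f -> k.+2%:R * x i <= 1].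
Proof.
move=> Sk.
have [f0 f0P] : exists f0, f0 \in [set f : {set T} | (f \subset S) & (#|f| == 3%N)].
  by apply/card_gt0P; rewrite cards_draws Sk bin_gt0.
pose P := [pred f : {set T} | (f \subset S) && (#|f| == 3%N)].
have Pf0 : P f0 by move: f0P; rewrite inE.
case: (@Order.TotalTheory.arg_minP _ R _ f0 P (fun f => \prod_(i in f) x i) Pf0).
move=> f /andP[fS /eqP f3] fmin; exists f; split=> //.
  by move=> g gS g3; apply: fmin; rewrite /= gS g3.
move=> i fi.
have xil l : l \in S :\: f -> x i <= x l.
  move=> /setDP[lS lf]; have lfi : l \notin f :\ i by rewrite inE (negPf lf) andbF.
  have : P (l |: (f :\ i)).
    rewrite /= subUset sub1set lS/= cardsU1 lfi.
    rewrite (subset_trans (subsetDl _ _) fS)/=.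
    by move: f3; rewrite (cardsD1 i f) fi => ->.
  move/fmin; rewrite big_setU1//= (big_setD1 i fi)/= ler_pM2r//.
  apply: prodr_gt0 => j; rewrite inE => /andP[_ jf].
  by move/subsetP/(_ j jf): fS; rewrite inE.
have iS : i \in S by exact: (subsetP fS).
(* Besides [x i] itself there are [k + 1] weights in [S] outside [f], all at least [x i], and the
   total weight is 1. *)
have -> : k.+2%:R * x i = x i + \sum_(l in S :\: f) x i.
  by rewrite sumr_const cardsD (setIidPr fS) Sk f3 !subSS subn0 -mulrS mulr_natl.
rewrite -sum_support1 (big_setD1 i iS)/= lerD2l.
rewrite [leRHS](big_setID (S :\: f))/= (setIidPr _); last first.
  apply/subsetP => l; rewrite !inE => /andP[lf ->]; rewrite andbT.
  by apply: contraNneq lf => ->.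
rewrite ler_wpDr ?sumr_ge0//; exact: ler_sum.
Qed.

Lemma medium_support (s : nat) : (4 <= s)%N -> #|S| = s.+1 ->
    #|E|%:R <= 'C(s, 3)%:R + 'C(s.-1, 2)%:R - (s%:R - 1) / 2 :> R ->
  6 * s%:R ^+ 3 * p < s%:R * (s%:R - 1) * (s%:R - 2).
Proof.
move=> s4 Sk Em; have s4R : 4 <= s%:R :> R by rewrite (ler_nat _ 4).
have [k sE] : exists k, s = k.+3 by exists (s - 3)%N; lia.
have s1E : k.+2%:R = s%:R - 1 :> R by rewrite sE -[k.+3%:R]natr1 addrK.
have [f [fS f3 fmin f1]] := @min_triple k (etrans Sk (congr1 succn sE)).
(* Weights in [f] are at most [1 / (s - 1)], and [s / (s - 1) <= 4 / 3] as [s >= 4]. *)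
have xf i : i \in f -> 0 < s%:R * x i /\ s%:R * x i <= 4 / 3.
  move=> fi; have xi : 0 < x i by move/subsetP/(_ i fi): fS; rewrite inE.
  have := f1 i fi; rewrite s1E => h; split; first by rewrite mulr_gt0//; lra.
  have : (s%:R - 1) * x i >= 3 * x i by rewrite ler_pM2r//; lra.
  lra.
have [u [v [w [uvw vw fE]]]] := cards3P f3.
have [u0 u43] : 0 < s%:R * x u /\ s%:R * x u <= 4 / 3.
  by apply: xf; rewrite fE !inE eqxx.
have [v0 v43] : 0 < s%:R * x v /\ s%:R * x v <= 4 / 3.
  by apply: xf; rewrite fE !inE eqxx orbT.
have [w0 w43] : 0 < s%:R * x w /\ s%:R * x w <= 4 / 3.
  by apply: xf; rewrite fE !inE eqxx !orbT.
have := triple_weight_gt s4R u0 u43 v0 v43 w0 w43.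
(* [C(s+1,3) - C(s,3) - C(s-1,2) = s - 1], and the last term of [Em] contributes another
   [(s - 1) / 2]. *)
have card_M : 3 * (s%:R - 1) <= 2 * #|missing|%:R :> R.
  have : 'C(s.+1, 3)%:R <= #|missing|%:R + #|E|%:R :> R.
    by rewrite -natrD ler_nat -Sk card_missing.
  have := bin2_natr R s; have := bin2_natr R s.-1.
  rewrite (_ : s.-1%:R = s%:R - 1 :> R); last by rewrite -s1E sE.
  rewrite binS natrD; lra.
have W : (\sum_(i in f) (1 - s%:R * x i) ^+ 2 * (3 * s%:R - 4 - 2 * (s%:R * x i))
    <= \sum_(i in S) (1 - s%:R * x i) ^+ 2 * (3 * s%:R - 4 - 2 * (s%:R * x i)))%R.
  rewrite [leRHS](big_setID f)/= (setIidPr fS) lerDl.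
  by apply: sumr_ge0 => i _; exact: weight_ge0.
rewrite fE (big_setU1 _ uvw)/= (big_setU1 _ vw)/= big_set1 in W.
(* With [card_M] this supplies the term [9 * (s - 1) * (a * b * c)] of [triple_weight_gt]. *)
have M : #|missing|%:R * (x u * (x v * x w)) <= \sum_(g in missing) \prod_(i in g) x i.
  rewrite mulr_natl -sumr_const; apply: ler_sum => g.
  rewrite inE => /andP[/andP[gS /eqP g3] _].
  by have := fmin g gS g3; rewrite fE (big_setU1 _ uvw)/= (big_setU1 _ vw)/= big_set1.
have s3 : 0 <= s%:R ^+ 3 :> R by rewrite exprn_ge0//; lra.
have xx : 0 <= s%:R ^+ 3 * (x u * (x v * x w)) by rewrite !mulr_ge0.
have {M}M := ler_wpM2l s3 M.
have {card_M}C := ler_wpM2r xx card_M.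
have pE := epoly_missing; have SE := elsym3_support s%:R.
rewrite Sk -[s.+1%:R]natr1 in SE.
have {}pE : 6 * s%:R ^+ 3 * p = 6 * s%:R ^+ 3 * elsym 3 S x
    - 6 * s%:R ^+ 3 * \sum_(f in missing) \prod_(i in f) x i by rewrite -pE; ring.
rewrite pE SE => TW.
have -> : s%:R + 1 - s%:R = 1 :> R by ring.
lra.
Qed.

Context (xmax : forall y, (forall i, 0 <= y i) -> \sum_i y i = 1 ->
  epoly E y <= epoly E x).

Lemma edges_ge_max_weight (a : R) : 0 < a -> (forall i, x i <= a) ->
  p * (3 * #|S|%:R * a - 2) <= #|E|%:R * a ^+ 3.
Proof.
move=> a0 xa.
apply: (@le_trans _ _ (\sum_i (a - 2 / 3 * x i) * epoly_deriv E x i)).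
  rewrite (bigID (mem S))/= ler_wpDr//.
    apply: sumr_ge0 => i _; apply: mulr_ge0; last exact: epoly_deriv_ge0.
    by have := xa i; have := x0 i; lra.
  have -> : p * (3 * #|S|%:R * a - 2) = \sum_(i in S) (a - 2 / 3 * x i) * (3 * p).
    by rewrite -mulr_suml sumrB sumr_const -mulr_sumr sum_support1 -mulr_natl; field.
  apply: ler_sum => i iS; apply: ler_wpM2l.
    by have := xa i; have := x0 i; lra.
  by apply: epoly_deriv_max => //; move: iS; rewrite inE.
rewrite sum_epoly_deriv [leRHS]mulr_natl -sumr_const; apply: ler_sum => e eE.
exact: edge_weight_le (E3 eE).
Qed.

(** The derivative is at least [3 * p] and at most the second elementary symmetric polynomial of the
    other weights, which sum to [1 - x i]. Cauchy-Schwarz bounds their squares from below. *)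
Lemma max_weight_bound i : 0 < x i ->
  6 * p * (#|S|%:R - 1) <= (1 - x i) ^+ 2 * (#|S|%:R - 2).
Proof.
move=> xi; have iS : i \in S by rewrite inE.
have dp : 3 * p <= epoly_deriv E x i := epoly_deriv_max E3 x0 x1 xmax xi.
have d2 : epoly_deriv E x i <= elsym 2 [set~ i] x.
  rewrite /epoly_deriv (sum_sets_mem _ (mem E) (fun e => \prod_(j in e :\ i) x j)).
  rewrite /elsym [leRHS](bigID (fun f => i |: f \in E))/= ler_wpDr//.
    by apply: sumr_ge0 => f _; exact: prod_set_ge0.
  rewrite le_eqVlt; apply/orP; left; apply/eqP; apply: eq_big => f.
    rewrite andbC subsetC sub1set inE; case: (boolP (i \in f)) => //= fi.
    have [/E3|] := boolP (i |: f \in E); rewrite ?andbF// andbT.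
    by rewrite cardsU1 fi add1n => -[->].
  by move=> /andP[_ fi]; rewrite setU1K.
have sC F : F 0 = 0 -> \sum_(j in [set~ i]) F (x j) = \sum_(j in S :\ i) F (x j) :> R.
  move=> F0; rewrite [LHS](bigID (mem S))/= [X in _ + X]big1 ?addr0.
    by apply: eq_bigl => j; rewrite !inE.
  by move=> j /andP[_ jS]; rewrite supportPn.
have e2 := elsym2E [set~ i] x.
rewrite (sC id)// (sC (fun y => y ^+ 2)) ?expr0n// in e2.
have s1 : \sum_(j in S :\ i) x j = 1 - x i.
  by rewrite -sum_support1 (big_setD1 i iS)/= addrAC subrr add0r.
rewrite s1 in e2; set q := \sum_(j in S :\ i) x j ^+ 2 in e2.
have kE : #|S :\ i|%:R = #|S|%:R - 1 :> R.
  by rewrite (cardsD1 i S) iS add1n -natr1 addrK.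
have [k0|k0] := posnP #|S :\ i|.
  have : #|S|%:R = 1 :> R by apply/eqP; rewrite -subr_eq0 -kE k0.
  by move=> ->; move: (s1); rewrite (cards0_eq k0) big_set0 => <-; lra.
have k1 : 0 < #|S|%:R - 1 :> R by rewrite -kE ltr0n.
have CS : (1 - x i) ^+ 2 <= (#|S|%:R - 1) * q.
  (* [c] is the mean of the other weights on the support. *)
  pose c := (1 - x i) / (#|S|%:R - 1).
  have : 0 <= \sum_(j in S :\ i) (x j - c) ^+ 2.
    by apply: sumr_ge0 => j _; exact: sqr_ge0.
  have -> : \sum_(j in S :\ i) (x j - c) ^+ 2 =
      q - 2 * c * (1 - x i) + c ^+ 2 * (#|S|%:R - 1).
    rewrite -s1 -kE mulr_natr -sumr_const mulr_sumr -sumrB -big_split/=.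
    by apply: eq_bigr => j _; ring.
  rewrite -(pmulr_rge0 _ k1) => h; rewrite -subr_ge0; apply: le_trans h _.
  by rewrite le_eqVlt; apply/orP; left; apply/eqP; rewrite /c; field; rewrite gt_eqF.
have : 6 * p * (#|S|%:R - 1) <= 2 * elsym 2 [set~ i] x * (#|S|%:R - 1).
  by rewrite ler_pM2r//; lra.
rewrite e2; lra.
Qed.

Lemma large_support (s : nat) : (4 <= s)%N -> (s.+1 < #|S|)%N ->
    #|E|%:R <= 'C(s, 3)%:R + 'C(s.-1, 2)%:R - (s%:R - 1) / 2 :> R ->
  6 * s%:R ^+ 3 * p < s%:R * (s%:R - 1) * (s%:R - 2).
Proof.
move=> s4 Sk Em; have s4R : 4 <= s%:R :> R by rewrite (ler_nat _ 4).
have [i0 iS] : exists i0, i0 \in S by apply/card_gt0P; apply: leq_trans Sk.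
case: (@Order.TotalTheory.arg_maxP _ R _ i0 xpredT x isT) => i _ imax.
have {}imax j : x j <= x i by exact: imax.
have xi : 0 < x i by apply: lt_le_trans (imax i0); move: iS; rewrite inE.
have k2 : s%:R + 2 <= #|S|%:R :> R by rewrite -natrD ler_nat addn2.
have ka : 1 <= #|S|%:R * x i.
  rewrite mulr_natl -[leLHS]sum_support1 -sumr_const.
  by apply: ler_sum => j _; exact: imax.
have s30 : 0 < s%:R ^+ 3 :> R by rewrite exprn_gt0//; lra.
rewrite ltNge; apply/negP => ge_p.
(* Six times the bound in [Em] is exactly this product. *)
have m6 : 6 * #|E|%:R <= (s%:R - 1) * (s%:R ^+ 2 + s%:R - 9) :> R.
  have := bin3_natr R s; have := bin2_natr R s.-1.
  rewrite (_ : s.-1%:R = s%:R - 1 :> R); last by rewrite -subn1 natrB//; lia.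
  lra.
have b1 := max_weight_bound xi.
have b2 := edges_ge_max_weight xi imax.
(* [b1] multiplied by [s ^+ 2], with [p] replaced by its assumed lower bound. *)
have H : (#|S|%:R - 1) * ((s%:R - 1) * (s%:R - 2)) <=
    (s%:R - s%:R * x i) ^+ 2 * (#|S|%:R - 2).
  have s0 : 0 < s%:R :> R by lra.
  have ge_p2 : (s%:R - 1) * (s%:R - 2) <= 6 * s%:R ^+ 2 * p.
    by rewrite -(ler_pM2l s0); lra.
  apply: (@le_trans _ _ (s%:R ^+ 2 * (6 * p * (#|S|%:R - 1)))).
    rewrite [leRHS](_ : _ = (#|S|%:R - 1) * (6 * s%:R ^+ 2 * p)); last by ring.
    by rewrite ler_pM2l//; lra.
  rewrite [leRHS](_ : _ = s%:R ^+ 2 * ((1 - x i) ^+ 2 * (#|S|%:R - 2))); last by ring.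
  by rewrite ler_pM2l// exprn_gt0.
have xi1 : x i < 1.
  rewrite lt_neqAle weight_le1 andbT; apply: contraTneq H => ->.
  by rewrite mulr1 subrr expr0n/= mul0r -ltNge !mulr_gt0//; lra.
have := @large_support_ineq _ s%:R #|S|%:R (s%:R * x i) s4R k2 _ _ H.
have -> : s%:R <= #|S|%:R * (s%:R * x i).
  by rewrite mulrCA ler_peMr//; lra.
have -> : s%:R * x i < s%:R by rewrite gtr_pMr//; lra.
move=> /(_ isT isT).
have s1 : 0 < s%:R - 1 :> R by lra.
rewrite -(ltr_pM2l s1).
have A3 : 0 <= (s%:R * x i) ^+ 3 by rewrite exprn_ge0// mulr_ge0//; lra.
have {m6}m6 := ler_wpM2r A3 m6.
have := ler_wpM2l (ltW s30) b2.
have w0 : 0 <= 3 * #|S|%:R * x i - 2 by lra.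
have := ler_wpM2r w0 ge_p.
lra.
Qed.

End Support.

(** * The complete 3-graph and the conclusion *)

(** Uniform weights [1 / s] attain this value. *)
Lemma lagrangian_complete3_ge (R : realType) (s : nat) : (0 < s)%N ->
  s%:R * (s%:R - 1) * (s%:R - 2) <= 6 * s%:R ^+ 3 * lagrangian R (complete3 s).
Proof.
move=> s0; have sR : 0 < s%:R :> R by rewrite ltr0n.
have [x _ [<- xmax]] := lagrangian_max R (complete3 s) s0.
pose u : 'rV[R]_s := \row_i s%:R^-1.
have uS : simplex R s u.
  split=> [i|]; first by rewrite mxE invr_ge0 ltW.
  under eq_bigr => i _ do rewrite mxE.
  by rewrite sumr_const card_ord -[LHS]mulr_natl divff// gt_eqF.
have uE : lagrange_poly (complete3 s) u = 'C(s, 3)%:R * s%:R^-1 ^+ 3.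
  rewrite /lagrange_poly (eq_bigr (fun=> s%:R^-1 ^+ 3)) => [|e].
    rewrite sumr_const -[LHS]mulr_natl; congr (_%:R * _).
    rewrite -[in RHS](card_ord s) -cardsT -cards_draws; apply: eq_card => e.
    by rewrite !inE subsetT.
  rewrite inE => /eqP e3; under eq_bigr => i _ do rewrite mxE.
  by rewrite prodr_const e3.
have := xmax u uS; rewrite uE -bin3_natr => h.
have s3 : 0 < 6 * s%:R ^+ 3 :> R by rewrite mulr_gt0// exprn_gt0.
have {h} := ler_wpM2l (ltW s3) h; apply: le_trans.
by rewrite le_eqVlt; apply/orP; left; apply/eqP; field; rewrite gt_eqF.
Qed.

Unset Implicit Arguments.

Theorem theorem4p1 (R : realType) (m t : nat) (m_gt0 : (0 < m)%N)
    (t_gt0 : (0 < t)%N)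
    (le_m : ('C(t - 1, 3) <= m)%N)
    (m_le : m%:R <= 'C(t - 1, 3)%:R + 'C(t - 2, 2)%:R - (t%:R - 2) / 2 :> R)
    (n : nat) (G : graph3 n) (mE : #|edges G| = m)
    (cliqueE : clique_number G = (t - 2)%N) :
  lagrangian R G < lagrangian R (complete3 (t - 1)).
Proof.
have E3 e : e \in edges G -> #|e| = 3%N.
  by move=> eG; apply/eqP; exact: (forall_inP (edges_card3 G)).
have clique_le K : is_clique G K -> (#|K| <= t - 2)%N.
  move=> cK; rewrite -cliqueE.
  exact: (leq_bigmax_cond (F := fun A : {set 'I_n} => #|A|)).
have [e0 e0G] : exists e, e \in edges G by apply/card_gt0P; rewrite mE.
(* A single edge is a clique of order 3, hence [3 <= t - 2]. *)
have t5 : (5 <= t)%N.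
  have : is_clique G e0.
    apply/forallP => f; apply/implyP => /andP[fe /eqP f3].
    by rewrite (_ : f = e0)//; apply/eqP; rewrite eqEcard fe f3 E3.
  by move/clique_le; rewrite E3//; lia.
have n0 : (0 < n)%N.
  by rewrite -[n]card_ord -cardsT (leq_trans _ (subset_leq_card (subsetT e0)))// E3.
have [s tE] : exists s, t = s.+1 by exists t.-1; rewrite prednK.
subst t; rewrite (_ : (s.+1 - 1)%N = s) in m_le *; last by lia.
rewrite (_ : (s.+1 - 2)%N = s.-1) in clique_le m_le; last by lia.
rewrite -[s.+1%:R]natr1 in m_le.
have Em : #|edges G|%:R <= 'C(s, 3)%:R + 'C(s.-1, 2)%:R - (s%:R - 1) / 2 :> R.
  by rewrite mE; lra.
have [v [v0 v1] [<- vmax]] := lagrangian_max R G n0.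
pose x i := v ord0 i.
have xmax (y : 'I_n -> R) : (forall i, 0 <= y i) -> \sum_i y i = 1 ->
    epoly (edges G) y <= epoly (edges G) x.
  move=> y0 y1; pose w : 'rV[R]_n := \row_i y i.
  have -> : epoly (edges G) y = lagrange_poly G w.
    by apply: eq_bigr => e _; apply: eq_bigr => i _; rewrite mxE.
  apply: vmax; split=> [i|]; first by rewrite mxE.
  by under eq_bigr => i _ do rewrite mxE.
have noK (K : {set 'I_n}) : #|K| = s -> exists2 f : {set 'I_n},
    (f \subset K) && (#|f| == 3%N) & f \notin edges G.
  move=> Ks; have : ~~ is_clique G K.
    by apply/negP => /clique_le; rewrite Ks; lia.
  by rewrite negb_forall => /existsP[f]; rewrite negb_imply => /andP[]; exists f.
have s4 : (4 <= s)%N by [].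
have lt_p : 6 * s%:R ^+ 3 * epoly (edges G) x < s%:R * (s%:R - 1) * (s%:R - 2).
  have [k_le|] := leqP #|[set i | 0 < x i]| s; first exact: small_support.
  rewrite leq_eqVlt => /orP[/eqP k_eq|k_gt]; first exact: medium_support.
  exact: large_support.
have s3 : 0 < 6 * s%:R ^+ 3 :> R by rewrite mulr_gt0// exprn_gt0// ltr0n; lia.
rewrite -(ltr_pM2l s3); apply: lt_le_trans lt_p _.
by apply: lagrangian_complete3_ge; lia.
Qed.
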